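(* Let $c(t)=(x(t),y(t),z(t))$, $t\in\mathbb{R}$, be a unit-speed geodesic of the Riemannian manifold $(Heis^3,g)$, where $g$ is the left-invariant metric for which the left-invariant fields $X,Y,T$ are orthonormal, with $c(0)=\mathbf{0}=(0,0,0)$. Write $\dot c(t)=\alpha(t)X(c(t))+\beta(t)Y(c(t))+\gamma(t)T(c(t))$ and $\gamma=\gamma(0)$. (i) If $\gamma\neq 0$, then for numbers $r\ge 0$ and $\phi\in\mathbb{R}$ determined by the initial condition $\dot c(0)=(r\cos\phi,\, r\sin\phi,\,\gamma)$, one has for all $t$ $$x(t)=\frac{r}{2\gamma}\bigl(\sin(2\gamma t+\phi)-\sin\phi\bigr),$$ $$y(t)=\frac{r}{2\gamma}\bigl(\cos\phi-\cos(2\gamma t+\phi)\bigr),$$ $$z(t)=\frac{1+\gamma^2}{2\gamma}\,t-\frac{1-\gamma^2}{4\gamma^2}\sin(2\gamma t).$$ (ii) If $\gamma=0$, then for all $t$ $$x(t)=\alpha(0)\,t,\qquad y(t)=\beta(0)\,t,\qquad z(t)=0.$$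
   Context: The Heisenberg group $Heis^3$ is $\mathbb{C}\times\mathbb{R}\cong\mathbb{R}^3$, with coordinates $(x,y,z)$ (the point $(x+iy,z)$), with the group law $$(x,y,z)\cdot(x',y',z')=(x+x',\,y+y',\,z+z'+xy'-yx').$$ The identity is $\mathbf{0}=(0,0,0)$. The vector fields, in the coordinates $(x,y,z)$, $$X=(1,0,-y),\qquad Y=(0,1,x),\qquad T=(0,0,1)$$ are left-invariant. The Riemannian metric $g$ on $Heis^3$ is the left-invariant metric for which $X,Y,T$ form an orthonormal frame at every point; in the coordinates $(x,y,z)$ its matrix is $$g=\begin{pmatrix} 1+y^2 & -xy & y \\ -xy & 1+x^2 & -x \\ y & -x & 1 \end{pmatrix}.$$ Geodesics are those of the Levi-Civita connection of $g$. At $\mathbf{0}$ the fields $X,Y,T$ coincide with the coordinate vectors $\partial_x,\partial_y,\partial_z$, so $\dot c(0)=(\alpha(0),\beta(0),\gamma(0))$. *)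

(* Defs.v *)
From HB Require Import structures.
From mathcomp Require Import all_boot all_order all_algebra.
From mathcomp Require Import all_classical all_reals all_analysis.
From mathcomp Require Import ring lra.
Set Implicit Arguments.
Unset Strict Implicit.
Unset Printing Implicit Defensive.
Import Order.TTheory GRing.Theory Num.Theory.
Import numFieldNormedType.Exports.
Local Open Scope classical_set_scope.
Local Open Scope ring_scope.

Section Riemannian.
Context {R : realType} {n : nat}.

(* A Riemannian metric in a global chart 'rV[R]_n is given by the matrix g p of
   its coefficients at each point p; tangent vectors are coordinate rows. *)
Implicit Type g : 'rV[R]_n -> 'M[R]_n.

Definition inner g (p u v : 'rV[R]_n) : R := (u *m g p *m v^T) 0 0.

Definition partial (i : 'I_n) (f : 'rV[R]_n -> R) (p : 'rV[R]_n) : R :=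
  'D_(delta_mx 0 i) f p.

(* A connection is given by its coefficients in the coordinate frame:
   nabla_{d_i} d_j = \sum_k Gamma p k i j d_k. *)
Definition is_levi_civita g (Gamma : 'rV[R]_n -> 'I_n -> 'I_n -> 'I_n -> R) :=
  (forall p k i j, Gamma p k i j = Gamma p k j i) /\
  (forall p i j l, partial i (fun q => g q j l) p =
     \sum_m Gamma p m i j * g p m l + \sum_m Gamma p m i l * g p j m).

Definition christoffel g (p : 'rV[R]_n) (k i j : 'I_n) : R :=
  2^-1 * \sum_l invmx (g p) k l *
    (partial i (fun q => g q j l) p + partial j (fun q => g q i l) p
     - partial l (fun q => g q i j) p).

Definition covariant_derivative g (c V : R -> 'rV[R]_n) (t : R) : 'rV[R]_n :=
  derive1 V t + \row_k \sum_i \sum_j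
    christoffel g (c t) k i j * (derive1 c t) 0 i * V t 0 j.

(* Twice differentiable is enough regularity for the equation to make sense. *)
Definition geodesic g (c : R -> 'rV[R]_n) :=
  [/\ forall t, derivable c t 1,
      forall t, derivable (derive1 c) t 1 &
      forall t, covariant_derivative g c (derive1 c) t = 0].

Definition unit_speed g (c : R -> 'rV[R]_n) :=
  forall t, inner g (c t) (derive1 c t) (derive1 c t) = 1.

Lemma christoffelP g Gamma :
  (forall p, (g p)^T = g p) -> (forall p, g p \in unitmx) ->
  is_levi_civita g Gamma <-> Gamma = christoffel g.
Proof.
move=> gT gU.
have gC p i j : g p i j = g p j i by rewrite -[in LHS]gT mxE.
have dC p i j l : partial i (fun q => g q j l) p = partial i (fun q => g q l j) p.
  by congr (partial i _ p); apply/funext => q; exact: gC.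
split=> [[sym comp]|->].
  pose low p i j l := \sum_m Gamma p m i j * g p m l.
  have cE p i j l : partial i (fun q => g q j l) p = low p i j l + low p i l j.
    rewrite comp; congr (_ + _); apply: eq_bigr => m _; by rewrite gC.
  have lowC p i j l : low p i j l = low p j i l.
    by apply: eq_bigr => m _; rewrite sym.
  apply/funext => p; apply/funext => k; apply/funext => i; apply/funext => j.
  rewrite /christoffel.
  under eq_bigr => l _.
    have -> : partial i (fun q => g q j l) p + partial j (fun q => g q i l) p
     - partial l (fun q => g q i j) p = 2 * low p i j l.
      by rewrite !cE (lowC p j i) (lowC p l i) (lowC p l j); ring.
    rewrite mulrCA /low; over.
  rewrite -mulr_sumr mulKf ?pnatr_eq0 //.
  transitivity (\sum_m Gamma p m i j * (1%:M : 'M[R]_n) m k).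
    rewrite (bigD1 k) //= mxE eqxx mulr1 big1 ?addr0 // => m mk.
    by rewrite mxE (negbTE mk) mulr0.
  rewrite -(mulmxV (gU p)).
  under eq_bigr do rewrite mxE mulr_sumr.
  rewrite exchange_big /=; apply: eq_bigr => l _; rewrite mulr_sumr.
  apply: eq_bigr => m _.
  have -> : invmx (g p) k l = invmx (g p) l k.
    by rewrite -[in LHS](gT p) -trmx_inv mxE.
  by ring.
split=> [p k i j|p i j l].
  congr (_ * _); apply: eq_bigr => l _; rewrite (dC p l i j); congr (_ * _); ring.
have low a b d : \sum_m christoffel g p m a b * g p m d =
    2^-1 * (partial a (fun q => g q b d) p + partial b (fun q => g q a d) p
     - partial d (fun q => g q a b) p).
  rewrite /christoffel.
  under eq_bigr do rewrite -mulrA mulr_suml.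
  rewrite -mulr_sumr; congr (_ * _).
  rewrite exchange_big /=.
  transitivity (\sum_e (1%:M : 'M[R]_n) d e *
    (partial a (fun q => g q b e) p + partial b (fun q => g q a e) p
     - partial e (fun q => g q a b) p)).
    rewrite -(mulmxV (gU p)); apply: eq_bigr => e _.
    rewrite mxE mulr_suml; apply: eq_bigr => m _; rewrite (gC p m d); ring.
  rewrite (bigD1 d) //= mxE eqxx mul1r big1 ?addr0 // => m md.
  by rewrite mxE eq_sym (negbTE md) mul0r.
under [X in _ = _ + X]eq_bigr do rewrite gC.
rewrite !low (dC p i l j).
have h2 : (2%:R : R) != 0 by rewrite pnatr_eq0.
by field.
Qed.

End Riemannian.

Section Heisenberg.
Context {R : realType}.

Definition row3 (a b d : R) : 'rV[R]_3 := \row_j [:: a; b; d]`_j.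

Definition heis_mul (p q : 'rV[R]_3) : 'rV[R]_3 :=
  row3 (p 0 0 + q 0 0) (p 0 1 + q 0 1)
       (p 0 2 + q 0 2 + p 0 0 * q 0 1 - p 0 1 * q 0 0).

Definition heisX (p : 'rV[R]_3) : 'rV[R]_3 := row3 1 0 (- p 0 1).
Definition heisY (p : 'rV[R]_3) : 'rV[R]_3 := row3 0 1 (p 0 0).
Definition heisT (p : 'rV[R]_3) : 'rV[R]_3 := row3 0 0 1.

Definition heis_metric (p : 'rV[R]_3) : 'M[R]_3 :=
  let x := p 0 0 in let y := p 0 1 in
  \matrix_(i, j) (nth [::] [:: [:: 1 + y ^+ 2; - (x * y);  y];
                               [:: - (x * y);  1 + x ^+ 2; - x];
                               [:: y;          - x;        1]] i)`_j.

Lemma row3E (a b d : R) :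
  (row3 a b d 0 0 = a) * (row3 a b d 0 1 = b) * (row3 a b d 0 2 = d).
Proof. by rewrite !mxE. Qed.

Lemma row3_eta (v : 'rV[R]_3) : v = row3 (v 0 0) (v 0 1) (v 0 2).
Proof.
apply/rowP; case=> [[|[|[|//]]] i]; rewrite mxE /=; congr (v 0 _); exact: val_inj.
Qed.

Lemma heis_innerE (p u v : 'rV[R]_3) :
  let om (w : 'rV[R]_3) := w 0 2 + p 0 1 * w 0 0 - p 0 0 * w 0 1 in
  inner heis_metric p u v = u 0 0 * v 0 0 + u 0 1 * v 0 1 + om u * om v.
Proof.
rewrite /inner (row3_eta u) (row3_eta v) !row3E.
rewrite mxE !big_ord_recl big_ord0 !mxE !big_ord_recl !big_ord0 !mxE /=.
by ring.
Qed.

Lemma heis_frame_orthonormal (p : 'rV[R]_3) (g := inner heis_metric p) :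
  [/\ g (heisX p) (heisX p) = 1, g (heisY p) (heisY p) = 1,
      g (heisT p) (heisT p) = 1 & [/\ g (heisX p) (heisY p) = 0,
      g (heisX p) (heisT p) = 0 & g (heisY p) (heisT p) = 0]].
Proof. by rewrite /g !heis_innerE !row3E; split; [ring..|split; ring]. Qed.

Lemma heis_metric_sym (p : 'rV[R]_3) : (heis_metric p)^T = heis_metric p.
Proof.
by apply/matrixP => -[[|[|[|//]]] i] [[|[|[|//]]] j]; rewrite !mxE.
Qed.

Lemma heis_metric_unit (p : 'rV[R]_3) : heis_metric p \in unitmx.
Proof.
pose F : 'M[R]_3 := \matrix_(i, j) [:: heisX p; heisY p; heisT p]`_i 0 j.
suff: F *m (heis_metric p *m F^T) = 1%:M by move=> /mulmx1_unit[_]; rewrite unitmx_mul => /andP[].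
apply/matrixP => -[[|[|[|//]]] i] [[|[|[|//]]] j];
  rewrite !(mxE, big_ord_recl, big_ord0) /=; ring.
Qed.

(* The differential at p of the left translation by a maps X, Y, T at p to
   X, Y, T at heis_mul a p. *)
Lemma heis_frame_left_invariant (a p : 'rV[R]_3) :
  [/\ 'D_(heisX p) (heis_mul a) p = heisX (heis_mul a p),
      'D_(heisY p) (heis_mul a) p = heisY (heis_mul a p) &
      'D_(heisT p) (heis_mul a) p = heisT (heis_mul a p)].
Proof.
have dL v : 'D_v (heis_mul a) p =
    row3 (v 0 0) (v 0 1) (v 0 2 + a 0 0 * v 0 1 - a 0 1 * v 0 0).
  apply/cvg_lim => //; apply: cvg_near_cst.
  near=> h; have h0 : h != 0 by near: h; exact: nbhs_dnbhs_neq.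
  rewrite /= /shift /=; apply/rowP; case=> [[|[|[|//]]] i]; rewrite !mxE /=; by field.
by rewrite !dL /heisX /heisY /heisT !row3E; split; congr row3; ring.
Unshelve. all: by end_near. Qed.

End Heisenberg.

(* Main.v *)
Require Import Defs.
From HB Require Import structures.
From mathcomp Require Import all_boot all_order all_algebra.
From mathcomp Require Import all_classical all_reals all_analysis.
From mathcomp Require Import ring.
Set Implicit Arguments.
Unset Strict Implicit.
Unset Printing Implicit Defensive.
Import Order.TTheory GRing.Theory Num.Theory.
Import numFieldNormedType.Exports.
Local Open Scope classical_set_scope.
Local Open Scope ring_scope.

(** Let omega = dz + y dx - x dy be the contact form, which reads off the
    T-component of a vector, and let J be the rotation by a right angle of the
    horizontal plane, J X = - Y, J Y = X, J T = 0.  The metric is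
    dx^2 + dy^2 + omega^2, so its only non-constant part is quadratic in omega,
    and d omega is constant in the coordinates.  Differentiating the metric and
    using that g(J u, v) is the antisymmetric form d omega(u, v) / 2 shows that

      Gamma(u, v) = omega(u) J v + omega(v) J u

    is symmetric and compatible with the metric; by uniqueness of the
    Levi-Civita connection these are the Christoffel symbols
    ([christoffel_heis_metric]), and no inverse metric has to be computed.

    A geodesic therefore satisfies c'' = - 2 omega(c') J c'.  In the frame
    X, Y, T this says that gamma is constant and that (alpha, beta) rotates with
    angular velocity 2 gamma ([heis_frame_ode]).  Hence
    (alpha, beta) = r (cos (2 gamma t + phi), sin (2 gamma t + phi))
    ([rotation_ode]), and the curve itself is recovered from x' = alpha,
    y' = beta, z' = gamma + x beta - y alpha.  Each closed formula is checked by
    comparing values at 0 and derivatives ([eq_is_derive]); unit speed enters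
    only through r^2 = 1 - gamma^2, in the formula for z. *)

(** * The Levi-Civita connection of the Heisenberg metric *)

Lemma is_derive_mx_coord (R : realFieldType) (V : normedModType R) (m n : nat)
    (M : V -> 'M[R]_(m, n)) (t v : V) (dM : 'M[R]_(m, n)) (i : 'I_m) (j : 'I_n) :
  is_derive t v M dM -> is_derive t v (fun x => M x i j) (dM i j).
Proof.
move=> [dvM <-]; rewrite (derive_mx dvM) mxE.
by apply: derivableP; move/derivable_mxP: dvM.
Qed.

Section LeviCivita.
Context {R : realType}.
Implicit Types p v : 'rV[R]_3.

Definition contact_form p : 'rV[R]_3 := row3 (p 0 1) (- p 0 0) 1.

Definition contact p v : R := (v *m (contact_form p)^T) 0 0.

(** The skew map J that represents d omega; it sends X, Y, T to - Y, X, 0. *)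
Definition horizontal_rot p v : 'rV[R]_3 := v 0 1 *: heisX p - v 0 0 *: heisY p.

(** The polarization of the quadratic map u |-> 2 omega(u) J u. *)
Definition heis_christoffel p (k i j : 'I_3) : R :=
  contact_form p 0 i * horizontal_rot p (delta_mx 0 j) 0 k +
  contact_form p 0 j * horizontal_rot p (delta_mx 0 i) 0 k.

Lemma contactE p v : contact p v = v 0 2 + p 0 1 * v 0 0 - p 0 0 * v 0 1.
Proof.
rewrite /contact (row3_eta v) !row3E !mxE !big_ord_recl big_ord0 !mxE /=; ring.
Qed.

(** The decomposition dx^2 + dy^2 + omega^2 of the metric: the first two squares
    have constant coefficients, so only omega contributes to derivatives. *)
Lemma heis_metricE p i j : heis_metric p i j =
  ((i == j) && (i != 2))%:R + contact_form p 0 i * contact_form p 0 j.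
Proof.
by case: i j => [[|[|[|//]]] i] [[|[|[|//]]] j]; rewrite !mxE /=; ring.
Qed.

Lemma is_derive_contact_form p v (j : 'I_3) :
  is_derive p v (fun q => contact_form q 0 j)
    (row3 (v 0 1) (- v 0 0) 0 0 j).
Proof.
have D k : is_derive p v (fun q : 'rV[R]_3 => q 0 k) (v 0 k).
  exact: is_derive_mx_coord (is_derive_id p v).
case: j => [[|[|[|//]]] j]; rewrite mxE /=.
- under eq_fun do rewrite mxE /=; exact: D.
- under eq_fun do rewrite mxE /=; exact: is_deriveN.
- under eq_fun do rewrite mxE /=; exact: is_derive_cst.
Qed.

(** The derivative of the coefficient omega_j along the i-th coordinate vector.
    Its antisymmetry makes it half of d omega evaluated on the coordinate vectors i, j. *)
Definition contact_diff (i j : 'I_3) : R :=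
  row3 (i == 1)%:R (- (i == 0)%:R) 0 0 j.

Lemma contact_diff_antisym i j : contact_diff i j = - contact_diff j i.
Proof.
by case: i j => [[|[|[|//]]] i] [[|[|[|//]]] j]; rewrite /contact_diff !mxE /=; ring.
Qed.

Lemma partial_heis_metric p (i j l : 'I_3) :
  partial i (fun q => heis_metric q j l) p =
  contact_diff i j * contact_form p 0 l + contact_form p 0 j * contact_diff i l.
Proof.
rewrite /partial.
under eq_fun do rewrite heis_metricE.
have D k := is_derive_contact_form p (delta_mx 0 i) k.
rewrite (@derive_val _ _ _ _ _ _ _ (is_deriveD (is_derive_cst _ _ _)
  (is_deriveM (D j) (D l)))) !mxE !eqxx /= add0r.
by rewrite /contact_diff !mxE ![i == _]eq_sym /GRing.scale /= addrC mulrC.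
Qed.

(** J represents d omega (up to the factor 2) with respect to the metric.  This
    is what turns derivatives of the metric into values of J. *)
Lemma horizontal_rot_metric p (j l : 'I_3) :
  \sum_m horizontal_rot p (delta_mx 0 j) 0 m * heis_metric p m l =
  contact_diff j l.
Proof.
rewrite !big_ord_recl big_ord0.
by case: j l => [[|[|[|//]]] j] [[|[|[|//]]] l]; rewrite /contact_diff !mxE /=; ring.
Qed.

(** Lowering the upper index gives omega_i D_jl + omega_j D_il, where D is
    [contact_diff].  Adding the same expression with j and l exchanged, the terms
    in omega_i cancel by antisymmetry of D, and what remains is the derivative of
    omega_j omega_l. *)
Lemma heis_christoffel_levi_civita :
  is_levi_civita (@heis_metric R) heis_christoffel.
Proof.
split=> [p k i j|p i j l]; first by rewrite /heis_christoffel addrC.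
have lower a b d : \sum_m heis_christoffel p m a b * heis_metric p m d =
    contact_form p 0 a * contact_diff b d + contact_form p 0 b * contact_diff a d.
  under eq_bigr do rewrite mulrDl -!mulrA.
  by rewrite big_split /= -!mulr_sumr !horizontal_rot_metric.
have metricC m : heis_metric p j m = heis_metric p m j.
  by rewrite -[in LHS]heis_metric_sym mxE.
under [X in _ = _ + X]eq_bigr do rewrite metricC.
rewrite partial_heis_metric !lower (contact_diff_antisym l j); ring.
Qed.

Lemma christoffel_heis_metric : christoffel (@heis_metric R) = heis_christoffel.
Proof.
apply/esym/(christoffelP _ heis_metric_sym heis_metric_unit).
exact: heis_christoffel_levi_civita.
Qed.

Lemma heis_christoffel_diag p v (k : 'I_3) :
  \sum_i \sum_j heis_christoffel p k i j * v 0 i * v 0 j =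
  2 * contact p v * horizontal_rot p v 0 k.
Proof.
rewrite contactE (row3_eta v) !row3E /heis_christoffel !big_ord_recl !big_ord0.
case: k => [[|[|[|//]]] k]; rewrite !mxE /=; ring.
Qed.

End LeviCivita.

(** * Elementary differential equations and polar coordinates *)

Section ODE.
Context {R : realType}.
Implicit Types (f g a b : R -> R) (w phi t : R).

(** Stated with an arbitrary common derivative [h], so that solving an ODE by an
    explicit formula reduces to one derivative computation and one evaluation. *)
Lemma eq_is_derive f g (h : R -> R) :
  (forall t, is_derive t 1 f (h t)) -> (forall t, is_derive t 1 g (h t)) ->
  f 0 = g 0 -> f =1 g.
Proof.
move=> df dg fg0 t; apply/eqP; rewrite -subr_eq0; apply/eqP.
have -> : f t - g t = f 0 - g 0; last by rewrite fg0 subrr.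
apply: (@is_derive_0_is_cst R (f - g) t 0) => s.
by rewrite -(subrr (h s)); apply: is_deriveB.
Qed.

Lemma is_derive_affine w phi t : is_derive t 1 (fun s => w * s + phi) w.
Proof. by apply: is_derive_eq; rewrite /GRing.scale /= addr0 mulr1. Qed.

Lemma is_derive_sin_affine w phi t :
  is_derive t 1 (fun s => sin (w * s + phi)) (w * cos (w * t + phi)).
Proof.
rewrite mulrC; apply: (@is_derive1_comp _ (@sin R) (fun s => w * s + phi)).
exact: is_derive_affine.
Qed.

Lemma is_derive_cos_affine w phi t :
  is_derive t 1 (fun s => cos (w * s + phi)) (- (w * sin (w * t + phi))).
Proof.
rewrite -mulrN mulrC; apply: (@is_derive1_comp _ (@cos R) (fun s => w * s + phi)).
exact: is_derive_affine.
Qed.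

(** The energy a^2 + b^2 is conserved, so it stays equal to 0. *)
Lemma rotation_ode_zero a b w :
  (forall t, is_derive t 1 a (- (w * b t))) ->
  (forall t, is_derive t 1 b (w * a t)) ->
  a 0 = 0 -> b 0 = 0 -> forall t, a t = 0 /\ b t = 0.
Proof.
move=> da db a0 b0 t.
have E : a t ^+ 2 + b t ^+ 2 = 0.
  apply: (@eq_is_derive (fun s => a s ^+ 2 + b s ^+ 2) (cst 0) (cst 0)) => [s|].
  - have := da s; have := db s => ? ?.
    by apply: is_derive_eq; rewrite /GRing.scale /=; ring.
  - by rewrite a0 b0 expr0n /= addr0.
by move/eqP: E; rewrite paddr_eq0 ?sqr_ge0 // !sqrf_eq0 => /andP[/eqP-> /eqP->].
Qed.

(** The system is linear and the right-hand sides solve it, so the difference is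
    a solution starting from 0. *)
Lemma rotation_ode a b w r phi :
  (forall t, is_derive t 1 a (- (w * b t))) ->
  (forall t, is_derive t 1 b (w * a t)) ->
  a 0 = r * cos phi -> b 0 = r * sin phi ->
  forall t, a t = r * cos (w * t + phi) /\ b t = r * sin (w * t + phi).
Proof.
move=> da db a0 b0 t.
have [//| |||/eqP + /eqP] := @rotation_ode_zero
    (fun s => a s - r * cos (w * s + phi)) (fun s => b s - r * sin (w * s + phi)) w _ _ _ _ t.
- move=> s; have := da s; have := is_derive_cos_affine w phi s => ? ?.
  by apply: is_derive_eq; rewrite /GRing.scale /=; ring.
- move=> s; have := db s; have := is_derive_sin_affine w phi s => ? ?.
  by apply: is_derive_eq; rewrite /GRing.scale /=; ring.
- by rewrite mulr0 add0r a0 subrr.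
- by rewrite mulr0 add0r b0 subrr.
by rewrite !subr_eq0 => /eqP-> /eqP->.
Qed.

(** The angle is acos (a / r) up to sign, the sign being that of b because acos
    takes values where the sine is nonnegative. *)
Lemma polar_coordinates (a b : R) :
  exists r phi : R, [/\ 0 <= r, a = r * cos phi & b = r * sin phi].
Proof.
pose r := Num.sqrt (a ^+ 2 + b ^+ 2).
have r2 : r ^+ 2 = a ^+ 2 + b ^+ 2 by rewrite sqr_sqrtr // addr_ge0 ?sqr_ge0.
have r_ge0 : 0 <= r by exact: sqrtr_ge0.
have [r0|rn0] := eqVneq r 0.
  move/esym/eqP: r2; rewrite r0 expr0n paddr_eq0 ?sqr_ge0 // !sqrf_eq0.
  by move=> /andP[/eqP-> /eqP->]; exists 0, 0; rewrite !mul0r.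
have q2 : (a / r) ^+ 2 + (b / r) ^+ 2 = 1.
  by rewrite !expr_div_n -mulrDl -r2 divff // sqrf_eq0.
have q1 : -1 <= a / r <= 1.
  rewrite -ler_norml -(@expr_le1 _ 2) // real_normK ?num_real //.
  by rewrite -q2 lerDl sqr_ge0.
have sin_q : sin (acos (a / r)) = `|b| / r.
  have -> : `|b| / r = `|b / r| by rewrite normrM normfV (ger0_norm r_ge0).
  by rewrite sin_acos // -sqrtr_sqr -q2 addrAC subrr add0r.
have cos_q : cos (acos (a / r)) = a / r by rewrite acosK // in_itv.
have [b0|b0] := leP 0 b.
  exists r, (acos (a / r)); rewrite sin_q cos_q ger0_norm //.
  by rewrite ![r * _]mulrC !divfK.
exists r, (- acos (a / r)); rewrite sinN cosN sin_q cos_q ltr0_norm //.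
by rewrite mulNr opprK ![r * _]mulrC !divfK.
Qed.

End ODE.

(** * Geodesics in the left-invariant frame *)

Section Geodesic.
Context {R : realType}.
Implicit Types (c : R -> 'rV[R]_3) (alpha beta gamma : R -> R).

Definition has_frame_components c alpha beta gamma :=
  forall t, derive1 c t =
    alpha t *: heisX (c t) + beta t *: heisY (c t) + gamma t *: heisT (c t).

(** The quadratic term Gamma(c', c') equals 2 omega(c') J c'. *)
Lemma heis_geodesic_equation c (t : R) : geodesic (@heis_metric R) c ->
  is_derive t 1 (derive1 c)
    (- (2 * contact (c t) (derive1 c t)) *: horizontal_rot (c t) (derive1 c t)).
Proof.
move=> [_ dc' /(_ t) c_eq]; have := derivableP (dc' t).
rewrite -derive1E.
suff -> : derive1 (derive1 c) t =
  - (2 * contact (c t) (derive1 c t)) *: horizontal_rot (c t) (derive1 c t) by [].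
apply/eqP; rewrite scaleNr -subr_eq0 opprK -c_eq; apply/eqP.
congr (_ + _); apply/rowP => k.
by rewrite christoffel_heis_metric [RHS]mxE heis_christoffel_diag mxE.
Qed.

Lemma heis_frame_components (p : 'rV[R]_3) (a b g : R) :
  let v := a *: heisX p + b *: heisY p + g *: heisT p in
  [/\ v 0 0 = a, v 0 1 = b, v 0 2 = g + p 0 0 * b - p 0 1 * a & contact p v = g].
Proof. by move=> v; rewrite contactE !mxE /=; split; ring. Qed.

Lemma heis_frame_curve c alpha beta gamma (t : R) :
  geodesic (@heis_metric R) c -> has_frame_components c alpha beta gamma ->
  [/\ is_derive t 1 (fun s => c s 0 0) (alpha t),
      is_derive t 1 (fun s => c s 0 1) (beta t) &
      is_derive t 1 (fun s => c s 0 2)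
        (gamma t + c t 0 0 * beta t - c t 0 1 * alpha t)].
Proof.
move=> [dc _ _] cE.
have D j : is_derive t 1 (fun s => c s 0 j) (derive1 c t 0 j).
  by apply: is_derive_mx_coord; rewrite derive1E; apply: derivableP.
have := heis_frame_components (c t) (alpha t) (beta t) (gamma t).
by rewrite /= -cE => -[<- <- <- _]; split; exact: D.
Qed.

(** The first two coordinates of X, Y, T are constant, so alpha and beta are the
    first two coordinates of c' and their equations are read off from c''.  Since
    gamma = omega(c'), its derivative is omega(c'') plus y' x' - x' y' = 0, and
    omega(c'') vanishes because J c' is horizontal. *)
Lemma heis_frame_ode c alpha beta gamma (t : R) :
  geodesic (@heis_metric R) c -> has_frame_components c alpha beta gamma ->
  [/\ is_derive t 1 alpha (- (2 * gamma t * beta t)),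
      is_derive t 1 beta (2 * gamma t * alpha t) &
      is_derive t 1 gamma 0].
Proof.
move=> geo cE.
have [dx dy dz] := heis_frame_curve t geo cE.
have coordE s : [/\ derive1 c s 0 0 = alpha s, derive1 c s 0 1 = beta s &
    contact (c s) (derive1 c s) = gamma s].
  by rewrite cE; have [-> -> _ ->] := heis_frame_components (c s) (alpha s) (beta s) (gamma s).
have aE : alpha = fun s => derive1 c s 0 0.
  by apply/funext => s; case: (coordE s).
have bE : beta = fun s => derive1 c s 0 1.
  by apply/funext => s; case: (coordE s).
have gE : gamma = fun s =>
    derive1 c s 0 2 + c s 0 1 * derive1 c s 0 0 - c s 0 0 * derive1 c s 0 1.
  by apply/funext => s; rewrite -contactE; case: (coordE s).
have D j := is_derive_mx_coord 0 j (heis_geodesic_equation t geo).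
have [v0 v1 om] := coordE t.
have rotE j : (- (2 * contact (c t) (derive1 c t)) *: horizontal_rot (c t) (derive1 c t)) 0 j =
    - (2 * gamma t) * (row3 (beta t) (- alpha t) (- (c t 0 1 * beta t + c t 0 0 * alpha t)) 0 j).
  rewrite om !mxE v0 v1; congr (_ * _).
  by case: j => [[|[|[|//]]] j] /=; ring.
split.
- by rewrite {1}aE; apply: (is_derive_eq (D 0)); rewrite rotE !mxE /= mulNr.
- by rewrite {1}bE; apply: (is_derive_eq (D 1)); rewrite rotE !mxE /= mulrNN.
- rewrite {1}gE.
  apply: (is_derive_eq (is_deriveB (is_deriveD (D 2) (is_deriveM dy (D 0)))
     (is_deriveM dx (D 1)))).
  by rewrite !rotE !row3E v0 v1 /GRing.scale /=; ring.
Qed.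

End Geodesic.

Theorem proposition2 (R : realType) (c : R -> 'rV[R]_3)
    (alpha beta gamma : R -> R)
    (c_geodesic : geodesic heis_metric c)
    (c_unit_speed : unit_speed heis_metric c)
    (c_init : c 0 = row3 0 0 0)
    (c_frame : forall t, derive1 c t =
       alpha t *: heisX (c t) + beta t *: heisY (c t) + gamma t *: heisT (c t)) :
  let x t := c t 0 0 in
  let y t := c t 0 1 in
  let z t := c t 0 2 in
  let g := gamma 0 in
  (g != 0 ->
    (exists r phi : R,
       0 <= r /\ derive1 c 0 = row3 (r * cos phi) (r * sin phi) g) /\
    (forall r phi : R, 0 <= r ->
       derive1 c 0 = row3 (r * cos phi) (r * sin phi) g ->
       forall t : R,
         [/\ x t = r / (2 * g) * (sin (2 * g * t + phi) - sin phi),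
             y t = r / (2 * g) * (cos phi - cos (2 * g * t + phi)) &
             z t = (1 + g ^+ 2) / (2 * g) * t
                   - (1 - g ^+ 2) / (4 * g ^+ 2) * sin (2 * g * t)])) /\
  (g = 0 ->
    forall t : R, [/\ x t = alpha 0 * t, y t = beta 0 * t & z t = 0]).
Proof.
move=> x y z g.
have D (t : R) := heis_frame_curve t c_geodesic c_frame.
have ODE (t : R) := heis_frame_ode t c_geodesic c_frame.
have gammaE (t : R) : gamma t = g.
  by apply: (@is_derive_0_is_cst R) => s; case: (ODE s).
have [x0 y0 z0] : [/\ x 0 = 0, y 0 = 0 & z 0 = 0].
  by rewrite /x /y /z c_init !row3E.
have c'0 : derive1 c 0 = row3 (alpha 0) (beta 0) g.
  have [v0 v1 v2 _] := heis_frame_components (c 0) (alpha 0) (beta 0) (gamma 0).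
  rewrite [LHS]row3_eta c_frame v0 v1 v2 -/(x 0) -/(y 0) x0 y0.
  by rewrite !mul0r subr0 addr0.
have speed : alpha 0 ^+ 2 + beta 0 ^+ 2 + g ^+ 2 = 1.
  rewrite -[RHS](c_unit_speed 0) heis_innerE /= c'0 !row3E.
  by rewrite -/(x 0) -/(y 0) x0 y0; ring.
have dx (t : R) : is_derive t 1 x (alpha t) by case: (D t).
have dy (t : R) : is_derive t 1 y (beta t) by case: (D t).
have dz (t : R) : is_derive t 1 z (g + x t * beta t - y t * alpha t).
  by rewrite -(gammaE t); case: (D t).
have da (t : R) : is_derive t 1 alpha (- (2 * g * beta t)).
  by rewrite -(gammaE t); case: (ODE t).
have db (t : R) : is_derive t 1 beta (2 * g * alpha t).
  by rewrite -(gammaE t); case: (ODE t).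
split=> [g0|g0].
- split.
    have [r [phi [r0 aE bE]]] := polar_coordinates (alpha 0) (beta 0).
    by exists r, phi; rewrite c'0 -aE -bE.
  move=> r phi r0 c'0E.
  have [a0 b0] : alpha 0 = r * cos phi /\ beta 0 = r * sin phi.
    move: c'0E; rewrite c'0 => E.
    by have := congr1 (fun v : 'rV_3 => (v 0 0, v 0 1)) E; rewrite !row3E => -[].
  have r2 : r ^+ 2 = 1 - g ^+ 2.
    rewrite -speed a0 b0 !exprMn -mulrDr cos2Dsin2; ring.
  have abE := rotation_ode da db a0 b0.
  have xE : x =1 (fun t => r / (2 * g) * (sin (2 * g * t + phi) - sin phi)).
    apply: (eq_is_derive dx) => [t|].
      have := is_derive_sin_affine (2 * g) phi t => ?.
      apply: is_derive_eq; rewrite (abE t).1 /GRing.scale /=.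
      by field.
    by rewrite x0 mulr0 add0r subrr mulr0.
  have yE : y =1 (fun t => r / (2 * g) * (cos phi - cos (2 * g * t + phi))).
    apply: (eq_is_derive dy) => [t|].
      have := is_derive_cos_affine (2 * g) phi t => ?.
      apply: is_derive_eq; rewrite (abE t).2 /GRing.scale /=.
      by field.
    by rewrite y0 mulr0 add0r subrr mulr0.
  have zE : z =1 (fun t => (1 + g ^+ 2) / (2 * g) * t
                   - (1 - g ^+ 2) / (4 * g ^+ 2) * sin (2 * g * t)).
    apply: (eq_is_derive dz) => [t|]; last by rewrite z0 !mulr0 sin0 mulr0 subrr.
    have := is_derive_sin_affine (2 * g) 0 t; under eq_fun do rewrite addr0.
    move=> ?; apply: is_derive_eq; rewrite /GRing.scale /=.
    have [-> ->] := abE t; rewrite xE yE.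
    (* The angle difference makes sin (2 g t + phi) and cos (2 g t + phi) the only
       functions of t, as on the side of x beta - y alpha. *)
    have -> : 2 * g * t + 0 = (2 * g * t + phi) - phi by ring.
    rewrite cosB -r2.
    (* Writing the 1 as r^2 (cos^2 + sin^2) + g^2 leaves a rational identity. *)
    have -> : 1 + g ^+ 2 =
        r ^+ 2 * (cos (2 * g * t + phi) ^+ 2 + sin (2 * g * t + phi) ^+ 2) + 2 * g ^+ 2.
      by rewrite cos2Dsin2 r2; ring.
    by field.
  by move=> t; split; [exact: xE|exact: yE|exact: zE].
- have dcst (f : R -> R) : (forall t : R, is_derive t 1 f 0) -> forall t, f t = f 0.
    by move=> df t; exact: is_derive_0_is_cst.
  have aE : forall t, alpha t = alpha 0.
    by apply: dcst => t; have := da t; rewrite g0 mulr0 mul0r oppr0.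
  have bE : forall t, beta t = beta 0.
    by apply: dcst => t; have := db t; rewrite g0 mulr0 mul0r.
  have lin (a t : R) : is_derive t 1 (fun s => a * s) a.
    by have := is_derive_affine a 0 t; under eq_fun do rewrite addr0.
  have xE : x =1 (fun t => alpha 0 * t).
    apply: (eq_is_derive dx) => [t|]; last by rewrite x0 mulr0.
    by rewrite aE; exact: lin.
  have yE : y =1 (fun t => beta 0 * t).
    apply: (eq_is_derive dy) => [t|]; last by rewrite y0 mulr0.
    by rewrite bE; exact: lin.
  move=> t; split=> //; rewrite -z0; apply: is_derive_0_is_cst => s.
  by apply: (is_derive_eq (dz s)); rewrite xE yE aE bE g0; ring.
Qed.
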